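(* Suppose that $\lambda$ is a singular limit of strongly compact cardinals. Then $\mathrm{U}(\lambda^+,2,\theta,\mathrm{cf}(\lambda)^+)$ fails for every infinite regular cardinal $\theta<\lambda$ with $\theta\neq\mathrm{cf}(\lambda)$.
   Context: For a set $X$ and a cardinal $\nu$, $[X]^\nu$ is the set of subsets of $X$ of size $\nu$. For sets of ordinals $a,b$, $a<b$ means $\alpha<\beta$ for all $\alpha\in a,\beta\in b$. For a collection $\mathcal B$ of sets of ordinals, $(a,b)\in[\mathcal B]^2$ means that $a,b$ are distinct elements of $\mathcal B$ with $a<b$. For $c:[\kappa]^2\to\theta$ and $\alpha<\beta<\kappa$, $c(\alpha,\beta)$ denotes $c(\{\alpha,\beta\})$, and for $a<b$, $c[a\times b]=\{c(\alpha,\beta)\mid\alpha\in a,\beta\in b\}$. For a regular uncountable cardinal $\kappa$ and cardinals $\mu,\theta,\chi\le\kappa$, $\mathrm{U}(\kappa,\mu,\theta,\chi)$ asserts the existence of a coloring $c:[\kappa]^2\to\theta$ such that for every $\chi'<\chi$, every family $\mathcal A\subseteq[\kappa]^{\chi'}$ consisting of $\kappa$-many pairwise disjoint sets, and every $i<\theta$, there exists $\mathcal B\in[\mathcal A]^\mu$ such that $\min(c[a\times b])>i$ for all $(a,b)\in[\mathcal B]^2$. A cardinal $\nu$ is strongly compact if it is uncountable and every $\nu$-complete filter can be extended to a $\nu$-complete ultrafilter. *)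

(* Defs.v *)
From mathcomp Require Import all_boot all_order.
From mathcomp Require Import boolp classical_sets functions cardinality filter.
From mathcomp Require Import wochoice.

Set Implicit Arguments.
Unset Strict Implicit.
Unset Printing Implicit Defensive.

Import Order.TTheory.
Local Open Scope classical_set_scope.
Local Open Scope card_scope.
Local Open Scope order_scope.

(* Cardinals are handled in two ways.  Where only the size matters, a cardinal
   is given by any set of that size, compared with #<=, #= and #<.  Where the
   ordinals below it matter, it is an [orderType] that is an initial ordinal
   (predicate [is_cardinal]); its points are then the ordinals below it. *)

Definition card_lt {T U : Type} (A : set T) (B : set U) : Prop :=
  A #<= B /\ ~ (B #<= A).

Notation "A '#<' B" := (card_lt A B) (at level 79, format "A  '#<'  B") :
  card_scope.

Definition is_cardinal {d} (K : orderType d) : Prop :=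
  well_order (<=%O : rel K) /\ forall x : K, [set y | y < x] #< [set: K].

Definition is_succ_card {T U : Type} (A : set T) (B : set U) : Prop :=
  A #< B /\ forall (V : Type) (S : set V), A #< S -> B #<= S.

Definition cofinal {d} {K : orderType d} (D : set K) : Prop :=
  forall x : K, exists2 y, D y & x <= y.

Definition is_cofinality {d} (K : orderType d) {T : Type} (C : set T) : Prop :=
  (exists2 D : set K, cofinal D & D #= C) /\
  forall D : set K, cofinal D -> C #<= D.

Definition regular_cardinal {d} (K : orderType d) : Prop :=
  [/\ is_cardinal K, infinite_set [set: K] & is_cofinality K [set: K]].

Definition singular_cardinal {d} (K : orderType d) : Prop :=
  [/\ is_cardinal K, infinite_set [set: K] & ~ is_cofinality K [set: K]].

Definition complete_for {T X : Type} (N : set T) (F : set_system X) : Prop :=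
  forall S : set_system X, S `<=` F -> S #< N -> F (\bigcap_(A in S) A).

(* The common universe [u] makes the filters range over every type living in
   the same universe as the cardinal itself. *)
Definition strongly_compact@{u +} {T : Type@{u}} (N : set T) : Prop :=
  ~ countable N /\
  forall (X : Type@{u}) (F : set_system X),
    ProperFilter F -> complete_for N F ->
    exists G : set_system X,
      [/\ UltraFilter G, complete_for N G & F `<=` G].

(* Cardinals smaller than |L| are exactly the sizes of the subsets of [L] that
   are smaller than [L]. *)
Definition limit_of_strongly_compacts {d} (L : orderType d) : Prop :=
  forall S : set L, S #< [set: L] ->
  exists N : set L, [/\ strongly_compact N, S #< N & N #< [set: L]].

Definition set_lt {d} {K : orderType d} (a b : set K) : Prop :=
  forall x y, a x -> b y -> x < y.

Definition is_min {d} {K : orderType d} (A : set K) (m : K) : Prop :=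
  A m /\ lbound A m.

(* A coloring of the unordered pairs is a function [c] of two arguments of which
   only the values [c x y] with [x < y] are ever used.  The set [c[a x b]] is
   never empty below: a family of [kappa > 1] pairwise disjoint sets of one
   common size [chi'] has no empty member. *)
Definition U_principle {dK dT} (kappa : orderType dK) {M : Type} (mu : set M)
    (theta : orderType dT) {X : Type} (chi : set X) : Prop :=
  exists c : kappa -> kappa -> theta,
  forall (X' : Type) (chi' : set X'), chi' #< chi ->
  forall A : set (set kappa),
    (forall a, A a -> a #= chi') -> A #= [set: kappa] -> trivIset A id ->
  forall i : theta,
  exists B : set (set kappa),
    [/\ B `<=` A, B #= mu &
      forall a b, B a -> B b -> a <> b -> set_lt a b ->
        exists2 m, is_min [set c x y | x in a & y in b] m & i < m].

(* Main.v *)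
(** Let [D] be cofinal in [lambda] of size [cf lambda]. For each [x] in [D], a
    strongly compact cardinal above [x] and [theta] gives an ultrafilter on
    [kappa], complete for it and containing all tails; along it, each [c a] is
    constant, with value [col a x]. As [theta <> cf lambda] is regular, some colour
    [i a] bounds [col a x] for cofinally many [x]; one colour [i] works for
    unboundedly many [a], the good ones. Writing an ordinal [e < kappa] as an
    increasing union of pieces of size less than [lambda] indexed by [D],
    completeness yields one [b x >= e] per piece such that each good [a < e] has
    [c a (b x) <= i] for some [x]. Blocks made of such [b x], [x] in [D], together
    with one good ordinal, form the required family once they are spaced out. *)
Require Import Defs.
From mathcomp Require Import all_boot all_order.
From mathcomp Require Import boolp classical_sets functions cardinality filter.
From mathcomp Require Import wochoice.

Set Implicit Arguments.
Unset Strict Implicit.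
Unset Printing Implicit Defensive.

Import Order.TTheory.
Local Open Scope classical_set_scope.
Local Open Scope card_scope.

(** * Comparison of cardinalities *)

Lemma card_le_fun T U (A : set T) (B : set U) (f : T -> U) :
  (forall x, A x -> B (f x)) ->
  (forall x y, A x -> A y -> f x = f y -> x = y) -> A #<= B.
Proof.
move=> AB injf; suff [g] : $|{injfun A >-> B}| by exact: inj_card_le.
by apply/injfunPex; exists f => // x y /set_mem Ax /set_mem Ay; exact: injf.
Qed.

(** The point [u] rules out an empty [U], into which an inhabited [T] has no total function even
    when [A] is empty. *)
Lemma card_leE T U (u : U) (A : set T) (B : set U) : A #<= B ->
  exists f : T -> U, (forall x, A x -> B (f x)) /\
    (forall x y, A x -> A y -> f x = f y -> x = y).
Proof.
elim/Ppointed: U u B => U u B; first by have := no u.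
move=> /pcard_leP/injfunPex[f AB injf].
by exists f; split=> // x y Ax Ay; apply: injf; rewrite inE.
Qed.

(** Zorn's lemma on graphs of partial injections from [A] to [B]: a maximal graph has domain [A] or
    range [B], since otherwise a pair of missed points could be added. *)
Lemma card_le_total T U (A : set T) (B : set U) : A #<= B \/ B #<= A.
Proof.
pose P (R : set (T * U)) := [/\ R `<=` A `*` B,
  forall x y y', R (x, y) -> R (x, y') -> y = y' &
  forall x x' y, R (x, y) -> R (x', y) -> x = x'].
have [F FP totF|R [[RAB Rfun Rinj] Rmax]] := @Zorn_bigcup _ P.
  split.
  - by move=> p [R FR Rp]; have [+ _ _] := FP _ FR; exact.
  - move=> x y y' [R FR Rp] [R' FR' Rp'].
    have [RR'|R'R] := totF _ _ FR FR'.
      by have [_ + _] := FP _ FR'; apply; [exact: RR' Rp|].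
    by have [_ + _] := FP _ FR; apply; [exact: Rp|exact: R'R].
  - move=> x x' y [R FR Rp] [R' FR' Rp'].
    have [RR'|R'R] := totF _ _ FR FR'.
      by have [_ _] := FP _ FR'; apply; [exact: RR' Rp|].
    by have [_ _] := FP _ FR; apply; [exact: Rp|exact: R'R].
have [|/existsNP[a /not_implyP[Aa nRa]]] :=
    pselect (forall x, A x -> exists y, R (x, y)).
  move=> domR; left; have [->|/set0P[a Aa]] := eqVneq A set0; first exact: card_ge0.
  have [u _] := domR _ Aa.
  have /choice[f fR] : forall x, exists y, A x -> R (x, y).
    move=> x; have [/domR[y Rxy]|] := pselect (A x); first by exists y.
    by move=> nAx; exists u.
  apply: (@card_le_fun _ _ _ _ f) => [x /fR /RAB[]//|x x' /fR Rx /fR Rx' ff].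
  by apply: Rinj Rx _; rewrite ff.
have [|/existsNP[b /not_implyP[Bb nRb]]] :=
    pselect (forall y, B y -> exists x, R (x, y)).
  move=> ranR; right.
  have /choice[f fR] : forall y, exists x, B y -> R (x, y).
    move=> y; have [/ranR[x Rxy]|] := pselect (B y); first by exists x.
    by move=> nBy; exists a.
  apply: (@card_le_fun _ _ _ _ f) => [x /fR /RAB[]//|x x' /fR Rx /fR Rx' ff].
  by apply: Rfun Rx _; rewrite ff.
exfalso; apply: (Rmax (R `|` [set (a, b)])).
  split; first by move=> p Rp; left.
  by move=> /(_ (a, b))/(_ (or_intror erefl)) Rab; apply: nRa; exists b.
split.
- by move=> p [/RAB//|->].
- move=> x y y' [Rxy|[-> ->]] [Rxy'|[]]//; first exact: Rfun Rxy Rxy'.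
  + by move=> xa; case: nRa; exists y; rewrite -xa.
  + by case: nRa; exists y'.
- move=> x x' y [Rxy|[-> ->]] [Rxy'|[]]//; first exact: Rinj Rxy Rxy'.
  + by move=> _ yb; case: nRb; exists x; rewrite -yb.
  + by case: nRb; exists x'.
Qed.

Lemma card_le_setX T T' U U' (A : set T) (A' : set T') (B : set U)
    (B' : set U') : A #<= B -> A' #<= B' -> A `*` A' #<= B `*` B'.
Proof.
move=> AB A'B'.
have [->|/set0P[[a a'] [Aa A'a']]] := eqVneq (A `*` A') set0.
  exact: card_ge0.
have [u _] : exists u : U, True.
  move: AB; elim/Ppointed: U B => U B; last by exists point.
  by rewrite card_le_emptyr => /eqP A0; rewrite A0 in Aa.
have [u' _] : exists u : U', True.
  move: A'B'; elim/Ppointed: U' B' => U' B'; last by exists point.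
  by rewrite card_le_emptyr => /eqP A0; rewrite A0 in A'a'.
have [f [fAB finj]] := card_leE u AB.
have [f' [fAB' finj']] := card_leE u' A'B'.
apply: (@card_le_fun _ _ _ _ (fun p => (f p.1, f' p.2))).
  by move=> [x x'] [Ax Ax']; split; [exact: fAB|exact: fAB'].
move=> [x x'] [y y'] [Ax Ax'] [Ay Ay'] [xy xy'].
by congr pair; [exact: finj|exact: finj'].
Qed.


(** * Hessenberg's theorem and cardinal arithmetic *)

(** These are the approximations to which Zorn's lemma is applied. The operation is total on [T],
    but only its values on the domain matter. *)
Record pairing T (A : set T) := Pairing {
  pairing_dom : set T;
  pairing_fun : T -> T -> T;
  pairing_sub : pairing_dom `<=` A;
  pairing_inf : infinite_set pairing_dom;
  pairing_in : forall x y, pairing_dom x -> pairing_dom y ->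
    pairing_dom (pairing_fun x y);
  pairing_inj : forall x y x' y', pairing_dom x -> pairing_dom y ->
    pairing_dom x' -> pairing_dom y' ->
    pairing_fun x y = pairing_fun x' y' -> x = x' /\ y = y' }.

(** A countable subset of [A], enumerated by [f] and decoded by [s], inherits a pairing of the
    natural numbers. *)
Lemma pairing_exists T (A : set T) : infinite_set A -> $|pairing A|.
Proof.
move=> Ainf; have [a _] := infinite_setN0 Ainf.
have [f [fA finj]] := card_leE a ((infiniteP _).1 Ainf).
have /card_eqPle[/(card_leE 0)[g [_ ginj]] _] := card_nat2.
pose D := f @` [set: nat].
have [s sP] : exists s : T -> nat, forall n, s (f n) = n.
  have /choice[s sP] : forall x, exists n, D x -> f n = x.
    move=> x; have [[n _ <-]|nDx] := pselect (D x); first by exists n.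
    by exists 0.
  by exists s => n; apply: finj => //; apply: sP; exists n.
split; apply: (@Pairing T A D (fun x y => f (g (s x, s y)))).
- by move=> _ [n _ <-]; exact: fA.
- apply/infiniteP; apply: (@card_le_fun _ _ _ _ f) => [n _|]; last exact: finj.
  by exists n.
- by move=> x y _ _; exists (g (s x, s y)).
- move=> _ _ _ _ [m _ <-] [n _ <-] [m' _ <-] [n' _ <-]; rewrite !sP.
  by move=> /(finj _ _ I I)/(ginj _ _ I I)[-> ->].
Qed.

(** The preorder form of Zorn's lemma is used because pairings that agree on a common domain may
    differ off it. A chain has an upper bound on the union of its domains, as any two points of the
    union lie in the domain of one member. *)
Lemma pairing_maximal T (A : set T) : infinite_set A ->
  exists p : pairing A, forall q : pairing A,
    pairing_dom p `<=` pairing_dom q ->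
    (forall x y, pairing_dom p x -> pairing_dom p y ->
      pairing_fun q x y = pairing_fun p x y) ->
    pairing_dom q `<=` pairing_dom p.
Proof.
move=> /pairing_exists[p0].
pose R (p q : pairing A) := `[< pairing_dom p `<=` pairing_dom q /\
  forall x y, pairing_dom p x -> pairing_dom p y ->
    pairing_fun q x y = pairing_fun p x y >].
have [|||p pmax] := @ZL_preorder _ p0 R.
- by move=> p; apply/asboolP; split.
- move=> p q r /asboolP[pq epq] /asboolP[qr eqr]; apply/asboolP.
  split; first exact: subset_trans pq qr.
  by move=> x y px py; rewrite eqr ?epq//; exact: pq.
- move=> F totF; have [->|/set0P[p1 Fp1]] := eqVneq F set0; first by exists p0.
  pose D := \bigcup_(p in F) pairing_dom p.
  have D2 x y : D x -> D y ->
      exists p, [/\ F p, pairing_dom p x & pairing_dom p y].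
    move=> [p Fp px] [q Fq qy].
    have [/asboolP[pq _]|/asboolP[qp _]] := totF _ _ Fp Fq.
      by exists q; split=> //; exact: pq.
    by exists p; split=> //; exact: qp.
  have [f fP] : exists f : T -> T -> T, forall p x y, F p ->
      pairing_dom p x -> pairing_dom p y -> f x y = pairing_fun p x y.
    have /choice[f fP] : forall xy : T * T, exists z, forall p, F p ->
        pairing_dom p xy.1 -> pairing_dom p xy.2 -> z = pairing_fun p xy.1 xy.2.
      move=> [x y]/=.
      have [[q [Fq qx qy]]|nq] := pselect (exists p, [/\ F p, pairing_dom p x &
        pairing_dom p y]); last first.
        by exists x => p Fp px py; case: nq; exists p.
      exists (pairing_fun q x y) => p Fp px py.
      by have [/asboolP[_ ->]|/asboolP[_ ->]] := totF _ _ Fp Fq.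
    by exists (fun x y => f (x, y)) => p x y; exact: (fP (x, y)).
  unshelve eexists (@Pairing T A D f _ _ _ _).
  + by move=> x [p _ px]; exact: (pairing_sub px).
  + apply: sub_infinite_set (@pairing_inf _ _ p1).
    by move=> x p1x; exists p1.
  + move=> x y Dx Dy; have [p [Fp px py]] := D2 _ _ Dx Dy.
    by exists p => //; rewrite (fP p)//; exact: pairing_in.
  + move=> x y x' y' Dx Dy Dx' Dy'.
    have [p [Fp px py]] := D2 _ _ Dx Dy.
    have [q [Fq qx' qy']] := D2 _ _ Dx' Dy'.
    have [/asboolP[pq _]|/asboolP[qp _]] := totF _ _ Fp Fq.
      by rewrite !(fP q)//; [apply: pairing_inj => //; exact: pq|exact: pq..].
    by rewrite !(fP p)//; [apply: pairing_inj => //; exact: qp|exact: qp..].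
  + move=> p Fp; apply/asboolP; split=> /= [x px|x y px py]; first by exists p.
    exact: fP.
by exists p => q pq epq; have /asboolP[] : R q p by exact/pmax/asboolP.
Qed.

(* Hessenberg's theorem, by Zorn's lemma on partial pairing functions: a pairing
   on [D] with [D] embeddable in [A `\` D] extends to [D `|` Y] for a copy [Y] of
   [D], since the three new blocks can be coded in [D] and moved to [Y]. *)
Lemma card_le_square T (A : set T) : infinite_set A -> A `*` A #<= A.
Proof.
move=> /[dup] Ainf /pairing_maximal[[D g DA Dinf gD ginj]/= pmax].
have [a Da] := infinite_setN0 Dinf.
(* [a] and [b] serve as tags: [g a] and [g b] are injective on [D] with disjoint ranges, so [D]
   holds two disjoint copies of itself. *)
have [b Db ab] : exists2 b, D b & a <> b.
  have [b [Db nab]] := infinite_setN0 (@infinite_setD _ D [set a] Dinf (finite_set1 a)).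
  by exists b => // ab; exact/nab.
have DD : D `*` D #<= D.
  apply: (@card_le_fun _ _ _ _ (fun p => g p.1 p.2)).
    by move=> [x y] [Dx Dy]; exact: gD.
  move=> [x y] [x' y'] [Dx Dy] [Dx' Dy']/= /ginj[]// -> -> //.
have [/(card_leE a)[h [hA hinj]]|] := card_le_total D (A `\` D); last first.
  move=> /(card_leE a)[h [hA hinj]].
  have AD : A #<= D.
    pose k x := if pselect (D x) then g a x else g b (h x).
    have kE x : A x -> (D x /\ k x = g a x) \/ (~ D x /\ k x = g b (h x)).
      by rewrite /k; case: pselect => Dx Ax; [left|right].
    apply: (@card_le_fun _ _ _ _ k) => [x|x y].
      by move=> /[dup] Ax /kE[[Dx ->]|[nDx ->]]; apply: gD => //; apply: hA.
    move=> /[dup] Ax /kE[[Dx ->]|[nDx ->]] /[dup] Ay /kE[[Dy ->]|[nDy ->]].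
    - by move=> /ginj[].
    - by move=> /ginj[]//; exact: hA.
    - by move=> /ginj[]//; [exact: hA|move=> /esym].
    - move=> /ginj[]//; [exact: hA|exact: hA|move=> _].
      by apply: hinj.
  apply: card_le_trans (subset_card_le DA).
  exact: card_le_trans (card_le_setX AD AD) DD.
exfalso.
pose Y := h @` D.
have YD x : Y x -> ~ D x by move=> [y /hA[_ nD] <-].
have [s sP] : exists s : T -> T, forall x, D x -> s (h x) = x.
  have /choice[s sP] : forall x, exists y, Y x -> D y /\ h y = x.
    move=> x; have [[y Dy <-]|nYx] := pselect (Y x); first by exists y.
    by exists a.
  exists s => x Dx; have [Ds hs] : D (s (h x)) /\ h (s (h x)) = h x.
    by apply: sP; exists x.
  exact: hinj.
(* The tags code [D] together with its copy [Y] inside [D]. *)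
pose k x := if pselect (D x) then g a x else g b (s x).
have kD x : D x -> k x = g a x by rewrite /k; case: pselect.
have kY x : D x -> k (h x) = g b x.
  move=> Dx; have nDhx : ~ D (h x) by apply: YD; exists x.
  by rewrite /k; case: pselect => //= _; rewrite sP.
have kin x : (D `|` Y) x -> D (k x).
  by move=> [Dx|[y Dy <-]]; [rewrite kD//|rewrite kY//]; apply: gD.
have kinj x y : (D `|` Y) x -> (D `|` Y) y -> k x = k y -> x = y.
  move=> [Dx|[x' Dx' <-]] [Dy|[y' Dy' <-]].
  - by rewrite !kD// => /ginj[].
  - by rewrite (kD x)// kY// => /ginj[].
  - by rewrite (kD y)// kY// => /ginj[]// /esym.
  - by rewrite !kY// => /ginj[]// _ ->.
(* Pairs not wholly in [D] receive their values in [Y], so they cannot collide with the values of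
   [g]. *)
pose f x y := if pselect (D x /\ D y) then g x y else h (g (k x) (k y)).
have fD x y : D x -> D y -> f x y = g x y.
  by move=> Dx Dy; rewrite /f; case: pselect => // -[].
have fE x y : (D x /\ D y /\ f x y = g x y) \/
    (~ (D x /\ D y) /\ f x y = h (g (k x) (k y))).
  by rewrite /f; case: pselect => [[]|]; [left|right].
have ghD x y : (D `|` Y) x -> (D `|` Y) y -> Y (h (g (k x) (k y))).
  by move=> Ex Ey; exists (g (k x) (k y)) => //; apply: gD; apply: kin.
suff q : exists2 q : pairing A, pairing_dom q = D `|` Y & pairing_fun q = f.
  case: q => q qD qf; have /YD : Y (h a) by exists a.
  apply; apply: (pmax q); rewrite ?qD ?qf; [by left|exact: fD|].
  by right; exists a.
unshelve eexists (@Pairing T A (D `|` Y) f _ _ _ _) => //.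
- by move=> x [/DA//|[y /hA[+ _] <-]].
- by apply: sub_infinite_set Dinf => x; left.
- move=> x y Ex Ey; have [[Dx [Dy ->]]|[_ ->]] := fE x y; first by left; exact: gD.
  by right; exact: ghD.
- move=> x y x' y' Ex Ey Ex' Ey'.
  have [[Dx [Dy ->]]|[_ ->]] := fE x y; have [[Dx' [Dy' ->]]|[_ ->]] := fE x' y'.
  + exact: ginj.
  + by move=> e; case: (YD _ (ghD _ _ Ex' Ey')); rewrite -e; exact: gD.
  + by move=> e; case: (YD _ (ghD _ _ Ex Ey)); rewrite e; exact: gD.
  + move=> /hinj-/(_ (gD _ _ (kin _ Ex) (kin _ Ey))).
    move=> /(_ (gD _ _ (kin _ Ex') (kin _ Ey'))).
    by move=> /ginj[]; try exact: kin; move=> /kinj-> // /kinj->.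
Qed.

(** A point is coded by the index of a set containing it and by its image under an injection of that
    set into [B]; Hessenberg's theorem brings these pairs back into [B]. *)
Lemma card_le_bigcup I T U (D : set I) (F : I -> set T) (B : set U) :
  infinite_set B -> D #<= B -> (forall i, D i -> F i #<= B) ->
  \bigcup_(i in D) F i #<= B.
Proof.
move=> Binf DB FB; have [u _] := infinite_setN0 Binf.
have [->|/set0P[_ [i0 _ _]]] := eqVneq (\bigcup_(i in D) F i) set0.
  exact: card_ge0.
have [d [dB dinj]] := card_leE u DB.
have /choice[f fP] : forall i, exists f : T -> U, D i ->
    (forall x, F i x -> B (f x)) /\
    (forall x y, F i x -> F i y -> f x = f y -> x = y).
  move=> i; have [Di|] := pselect (D i); last by exists (fun=> u).
  by have [f] := card_leE u (FB _ Di); exists f.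
have /choice[j jP] : forall x, exists i, (\bigcup_(i in D) F i) x -> D i /\ F i x.
  move=> x; have [[i Di Fix]|nx] := pselect ((\bigcup_(i in D) F i) x).
    by exists i.
  by exists i0.
apply: card_le_trans (card_le_square Binf).
apply: (@card_le_fun _ _ _ _ (fun x => (d (j x), f (j x) x))).
  by move=> x /jP[Dj Fj]; split; [exact: dB|exact: (fP _ Dj).1].
move=> x y /jP[Dx Fx] /jP[Dy Fy] [/(dinj _ _ Dx Dy) jxy].
by rewrite jxy in Fx Dx *; apply: (fP _ Dy).2.
Qed.

Lemma card_le_setU T U (A A' : set T) (B : set U) :
  infinite_set B -> A #<= B -> A' #<= B -> A `|` A' #<= B.
Proof.
move=> Binf AB A'B; rewrite -bigcup2E; apply: card_le_bigcup => //.
  exact/infiniteP.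
by move=> [|[|i]] _ //=; exact: card_ge0.
Qed.

Lemma card_ltNge T U (A : set T) (B : set U) : A #< B <-> ~ (B #<= A).
Proof. by split=> [[]//|nBA]; split=> //; have [|/nBA] := card_le_total A B. Qed.

Lemma card_le_lt_trans T U V (A : set T) (B : set U) (C : set V) :
  A #<= B -> B #< C -> A #< C.
Proof.
move=> AB /card_ltNge CB; apply/card_ltNge => CA; apply: CB.
exact: card_le_trans CA AB.
Qed.

Local Open Scope order_scope.

(** * Initial ordinals and successor cardinals *)

Lemma well_order_wf d (K : orderType d) :
  well_order (<=%O : rel K) -> well_founded (fun x y : K => x < y).
Proof.
move=> wo x; apply: contrapT => nAx.
have [|z [[/asboolP nAz zmin] _]] := wo (fun y => `[< ~ Acc (fun x y : K => x < y) y >]).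
  by exists x; apply/asboolP.
apply: nAz; constructor => y yz; apply: contrapT => nAy.
by have /(_ _)/wrap[] := zmin y; [apply/asboolP|rewrite leNgt yz].
Qed.

(** Adjoining the endpoint does not raise the size of an infinite segment, and a finite segment
    stays finite. *)
Lemma cardinal_initial_segment d (K : orderType d) : is_cardinal K ->
  infinite_set [set: K] -> forall x : K, [set y | y <= x] #< [set: K].
Proof.
move=> [_ segK] Kinf x; apply/card_ltNge => Kx.
have lex : [set y | y <= x] `<=` [set y | y < x] `|` [set x].
  by move=> y /=; rewrite le_eqVlt => /orP[/eqP|]; [right|left].
have ltinf : infinite_set [set y | y < x].
  move=> ltfin; apply: Kinf; apply: card_le_finite Kx _.
  by apply: sub_finite_set lex _; rewrite finite_setU; split.
have [_] := segK x; apply; apply: card_le_trans Kx _.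
apply: card_le_trans (subset_card_le lex) _; apply: card_le_setU => //.
have [y yx] := infinite_setN0 ltinf.
by apply: (@card_le_fun _ _ _ _ (fun=> y)) => // u v -> ->.
Qed.

Lemma cardinal_no_max d (K : orderType d) : is_cardinal K ->
  infinite_set [set: K] -> forall x : K, exists y, x < y.
Proof.
move=> Kcard Kinf x; have [_ nKx] := cardinal_initial_segment Kcard Kinf x.
apply: contrapT => /forallNP xmax; apply: nKx; apply: subset_card_le => y _ /=.
by rewrite leNgt; apply/negP/xmax.
Qed.

Lemma finite_set_ubound d (K : orderType d) (x0 : K) (D : set K) :
  finite_set D -> exists m, forall x, D x -> x <= m.
Proof.
move=> /finite_seqP[s ->]; elim: s => [|a s [m sm]]; first by exists x0.
exists (Order.max a m) => x /=; rewrite inE => /orP[/eqP->|/sm xm].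
  by rewrite le_max lexx.
by rewrite le_max xm orbT.
Qed.

Lemma cofinal_infinite d (K : orderType d) (D : set K) : is_cardinal K ->
  infinite_set [set: K] -> cofinal D -> infinite_set D.
Proof.
move=> Kcard Kinf Dcof; have [x0 _] := infinite_setN0 Kinf.
move=> /(finite_set_ubound x0)[m Dm].
have [y my] := cardinal_no_max Kcard Kinf m.
have [z /Dm zm yz] := Dcof y.
by have := lt_le_trans my (le_trans yz zm); rewrite ltxx.
Qed.

Lemma succ_card_infinite T U (L : set T) (B : set U) :
  infinite_set L -> is_succ_card L B -> infinite_set B.
Proof. by move=> Linf [[LB _] _] /(card_le_finite LB). Qed.

Lemma succ_card_segment d (K : orderType d) T (L : set T) : infinite_set L ->
  is_cardinal K -> is_succ_card L [set: K] ->
  forall x : K, [set y | y <= x] #<= L.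
Proof.
move=> Linf Kcard Ksucc x.
have Kinf := succ_card_infinite Linf Ksucc.
have /card_ltNge nK := cardinal_initial_segment Kcard Kinf x.
by apply: contrapT => /card_ltNge/(Ksucc.2 _ _)/nK.
Qed.

(** Regularity of a successor cardinal: the closed segments below the points of an unbounded [E]
    would cover [K] by at most [L] many sets of size at most that of [L]. *)
Lemma succ_card_bounded d (K : orderType d) T (L : set T) : infinite_set L ->
  is_cardinal K -> is_succ_card L [set: K] ->
  forall E : set K, E #<= L -> exists e, forall x, E x -> x < e.
Proof.
move=> Linf Kcard Ksucc E EL; apply: contrapT => /forallNP nE.
have [[_ +] _] := Ksucc; apply.
apply: card_le_trans (card_le_bigcup Linf EL
  (fun x _ => succ_card_segment Linf Kcard Ksucc x)).
apply: subset_card_le => y _.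
have /existsNP[x /not_implyP[Ex nxy]] := nE y.
by exists x => //=; rewrite leNgt; apply/negP.
Qed.

(** A tail no larger than [L] would be bounded, which is absurd. This leaves room above any ordinal
    for padding a block. *)
Lemma succ_card_tail d (K : orderType d) T (L : set T) : infinite_set L ->
  is_cardinal K -> is_succ_card L [set: K] ->
  forall x : K, L #<= [set y | x <= y].
Proof.
move=> Linf Kcard Ksucc x.
have [//|/(succ_card_bounded Linf Kcard Ksucc)[e xe]] := card_le_total L [set y | x <= y].
have /xe : x <= Order.max e x by rewrite le_max lexx orbT.
by rewrite gt_max ltxx.
Qed.

(** * Complete filters, cofinal colours and spaced sequences *)

(** By regularity of the successor cardinal, the starting points of fewer than [N] tails have a
    common bound. Strong compactness will extend this filter to an ultrafilter. *)
Lemma complete_tail_filter d (K : orderType d) T (L : set T) S (N : set S) :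
  infinite_set L -> is_cardinal K -> is_succ_card L [set: K] -> N #<= L ->
  let F := [set A : set K | exists e, [set y | e <= y] `<=` A] in
  ProperFilter F /\ complete_for N F.
Proof.
move=> Linf Kcard Ksucc NL F; split.
  split; first by move=> [e /(_ e)]; apply => /=.
  split.
  - have [x _] := infinite_setN0 (succ_card_infinite Linf Ksucc).
    by exists x.
  - move=> A B [e eA] [e' e'B]; exists (Order.max e e') => y /=.
    by rewrite ge_max => /andP[ey e'y]; split; [exact: eA|exact: e'B].
  - by move=> A B AB [e eA]; exists e; exact: subset_trans AB.
move=> G GF [GN _].
have /choice[e eP] : forall A : set K, exists e, G A -> [set y | e <= y] `<=` A.
  move=> A; have [/GF[e eA]|nGA] := pselect (G A); first by exists e.
  have [x _] := infinite_setN0 (succ_card_infinite Linf Ksucc).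
  by exists x.
have [] := @succ_card_bounded _ _ _ _ Linf Kcard Ksucc (e @` G).
  exact: card_le_trans (card_image_le _ _) (card_le_trans GN NL).
move=> m em; exists m => y /= my A GA; apply: (eP _ GA) => /=.
by apply: le_trans my; apply/ltW/em; exists A.
Qed.

(** If no fibre were in [G], all their complements would be; there are fewer than [N] of them, and
    their intersection is empty. *)
Lemma ultrafilter_fiber X T S (N : set S) (G : set_system X) (f : X -> T) :
  UltraFilter G -> complete_for N G -> [set: T] #< N ->
  exists t, G (f @^-1` [set t]).
Proof.
move=> GU GN TN; apply: contrapT => /forallNP nf.
apply: (@filter_not_empty _ G _).
suff <- : \bigcap_(A in [set ~` (f @^-1` [set t]) | t in [set: T]]) A = set0.
  apply: GN; first by move=> _ [t _ <-]; have [/nf|] := in_ultra_setVsetC (f @^-1` [set t]) GU.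
  exact: card_le_lt_trans (card_image_le _ _) TN.
apply/seteqP; split=> // x xA.
by have := xA (~` (f @^-1` [set f x])); apply=> //; exists (f x).
Qed.

(* If [cf < theta], a set of [cf] colours is bounded in [theta]; if
   [theta < cf], a partition into [theta] pieces has a cofinal piece. *)
Lemma cofinal_bounded_color dL dT (L : orderType dL) (theta : orderType dT)
    C (cf : set C) (D : set L) (f : L -> theta) :
  is_cofinality L cf -> cofinal D -> D #= cf -> regular_cardinal theta ->
  ~ ([set: theta] #= cf) ->
  exists i, cofinal [set x | D x /\ f x <= i].
Proof.
move=> [_ cfmin] Dcof Dcf [_ thinf [_ thmin]] thcf; apply: contrapT => /forallNP nf.
(* If the points of colour at most [i] are bounded by [e i] for every [i], then the range of [e] is
   cofinal. *)
have cfth : cf #<= [set: theta].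
  have /choice[e eP] : forall i, exists e, forall x, D x -> f x <= i -> x < e.
    move=> i; have /existsNP[e ne] := nf i; exists e => x Dx fxi.
    by rewrite ltNge; apply/negP => ex; apply: ne; exists x.
  apply: card_le_trans (cfmin (range e) _) (card_image_le _ _) => x.
  have [y Dy xy] := Dcof x; exists (e (f y)); first by exists (f y).
  exact: le_trans xy (ltW (eP _ _ Dy (lexx _))).
have [i iP] : exists i, forall x, D x -> f x <= i.
  apply: contrapT => /forallNP nb; apply: thcf; rewrite card_eq_sym.
  apply/card_eqPle; split=> //.
  apply: card_le_trans (thmin (f @` D) _) (card_le_trans (card_image_le _ _) _).
    move=> i; have /existsNP[x /not_implyP[Dx nfx]] := nb i.
    by exists (f x); [exists x|rewrite leNgt; apply/negP => /ltW].
  by move: Dcf => /card_eqPle[].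
apply: (nf i) => x; have [y Dy xy] := Dcof x.
by exists y => //; split=> //; exact: iP.
Qed.

(** Well-founded recursion: [h x] is an upper bound of the earlier values [g (h y)]. It will space
    out the blocks. *)
Lemma dominating_sequence d (K : orderType d) (g : K -> K) :
  well_order (<=%O : rel K) ->
  (forall (f : K -> K) x, exists e, forall y, y < x -> f y <= e) ->
  exists h : K -> K, forall x y, y < x -> g (h y) <= h x.
Proof.
move=> /well_order_wf wf bnd.
have [[x0 _]|noK] := pselect (exists x : K, True); last first.
  by exists id => x; case: noK; exists x.
(* Choosing bounds for all sets, with a default on unbounded ones, lets the recursion run before the
   earlier values are known to be bounded. *)
have /choice[s sP] : forall E : set K, exists e,
    (exists e, forall x, E x -> x <= e) -> forall x, E x -> x <= e.
  move=> E; have [[e eP]|ne] := pselect (exists e, forall x, E x -> x <= e).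
    by exists e.
  by exists x0.
pose F (x : K) (p : forall y : K, y < x -> K) := s [set z | exists (y : K) (H : y < x), z = g (p y H)].
pose h := Fix wf (fun=> K) F.
have hE x : h x = s [set z | exists (y : K) (_ : y < x), z = g (h y)].
  rewrite /h Fix_eq// => {}x p q pq; rewrite /F.
  by congr (s _); apply/funext => z; apply/propext;
    split=> -[y [H ->]]; exists y, H; rewrite pq.
exists h => x y yx; rewrite [leRHS]hE; apply: sP; last by exists y, yx.
have [e eP] := bnd (g \o h) x.
by exists e => z [t [tx ->]]; exact: eP.
Qed.

(** * Colourings of the successor of a singular limit of strongly compact cardinals *)

Section SingularLimit.
Variables (dL dK dT : Order.disp_t).
Variables (lambda : orderType dL) (kappa : orderType dK) (theta : orderType dT).
Variables (D : set lambda) (c : kappa -> kappa -> theta).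
Hypothesis lambda_card : is_cardinal lambda.
Hypothesis lambda_inf : infinite_set [set: lambda].
Hypothesis lambda_limit : limit_of_strongly_compacts lambda.
Hypothesis kappa_card : is_cardinal kappa.
Hypothesis kappa_succ : is_succ_card [set: lambda] [set: kappa].
Hypothesis D_cofinality : is_cofinality lambda D.
Hypothesis D_cofinal : cofinal D.
Hypothesis theta_regular : regular_cardinal theta.
Hypothesis theta_lt : [set: theta] #< [set: lambda].
Hypothesis theta_neq : ~ ([set: theta] #= D).

Let kappa_inf : infinite_set [set: kappa].
Proof. exact: succ_card_infinite lambda_inf kappa_succ. Qed.

Let bounded := succ_card_bounded lambda_inf kappa_card kappa_succ.

(** A strongly compact [N] above both the segment of [x] and [theta] extends the tail filter, which
    is [N]-complete because [N] is below [lambda]. *)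
Lemma limit_ultrafilter (x : lambda) :
  exists N : set lambda, exists G : set_system kappa,
    [/\ [set y | y <= x] #< N, [set: theta] #< N, UltraFilter G,
      complete_for N G & forall e, G [set y | e <= y]].
Proof.
(* [S] is the larger of the two; [theta] is copied into [lambda] because the limit hypothesis speaks
   of subsets of [lambda]. *)
have [S [SL xS thS]] : exists S : set lambda, [/\ S #< [set: lambda],
    [set y | y <= x] #<= S & [set: theta] #<= S].
  have segL := cardinal_initial_segment lambda_card lambda_inf x.
  have [thx|xth] := card_le_total [set: theta] [set y | y <= x].
    by exists [set y | y <= x]; split=> //; exact: card_lexx.
  have [f [_ finj]] := card_leE x theta_lt.1.
  have /card_eqPle[fth thf] : range f #= [set: theta].
    by apply: inj_card_eq => u v _ _; exact: finj.
  exists (range f); split=> //; first exact: card_le_lt_trans fth theta_lt.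
  exact: card_le_trans xth thf.
have [N [[_ Nsc] SN NL]] := lambda_limit SL.
have [Fproper Fcomplete] :=
  complete_tail_filter lambda_inf kappa_card kappa_succ NL.1.
have [G [GU GN FG]] := Nsc _ _ Fproper Fcomplete.
exists N, G; split=> //; [exact: card_le_lt_trans xS SN|
  exact: card_le_lt_trans thS SN|].
by move=> e; apply: FG; exists e.
Qed.

(* [col a x] is the value of [c a] on a set in the ultrafilter attached to [x]. *)
Lemma limit_color : exists col : kappa -> lambda -> theta,
  forall (x : lambda) (E : set kappa) (e : kappa), E #<= [set y | y <= x] ->
    exists b, e <= b /\ forall a, E a -> c a b = col a x.
Proof.
have /choice[N NP] := limit_ultrafilter.
have /choice[G GP] := NP.
have /choice[col colP] : forall ax : kappa * lambda, exists t,
    G ax.2 [set b | c ax.1 b = t].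
  move=> [a x]/=; have [_ thN GU GN _] := GP x.
  exact: ultrafilter_fiber (c a) GU GN thN.
exists (fun a x => col (a, x)) => x E e Ex.
have [xN _ GU GN Gtail] := GP x.
have GE : G x (\bigcap_(A in
    [set [set b | c a b = col (a, x)] | a in E]) A).
  apply: GN; first by move=> _ [a _ <-]; exact: (colP (a, x)).
  exact: card_le_lt_trans (card_le_trans (card_image_le _ _) Ex) xN.
have [b [eb bE]] := filter_ex (filterI (Gtail e) GE).
by exists b; split=> // a Ea; apply: (bE [set b | c a b = col (a, x)]); exists a.
Qed.

(** Pigeonhole: were the ordinals of each colour bounded, the [theta] many bounds would have a
    common bound in [kappa], since [theta] is below [lambda]. *)
Lemma unbounded_color (col : kappa -> lambda -> theta) : exists i,
  forall e, exists2 a, e <= a & cofinal [set x | D x /\ col a x <= i].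
Proof.
have /choice[i iP] : forall a, exists i, cofinal [set x | D x /\ col a x <= i].
  by move=> a; apply: cofinal_bounded_color D_cofinality _ _ _ _.
apply: contrapT => /forallNP ni.
have /choice[e eP] : forall j, exists e, forall a, i a = j -> a < e.
  move=> j; have /existsNP[e ne] := ni j; exists e => a iaj.
  by rewrite ltNge; apply/negP => ea; apply: ne; exists a => //; rewrite -iaj.
have [m mP] := bounded (card_le_trans (card_image_le e setT) theta_lt.1).
(* The ordinal [m] has a colour too, so it lies below the bound [e (i m)], which lies below [m]. *)
have := lt_trans (eP _ m erefl) (mP _ (imageP e I)).
by rewrite ltxx.
Qed.

(** [P] collects the good ordinals. As [i] and [P] are fixed before [e], the good point of one block
    is caught by every block based above it. *)
Lemma block_exists : exists i : theta, exists P : set kappa,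
  forall e : kappa, exists a : set kappa,
    [/\ a #= D, forall y, a y -> e <= y, exists2 x, a x & P x &
      forall x, P x -> x < e -> exists2 y, a y & c x y <= i].
Proof.
have [col colP] := limit_color.
have [i iP] := unbounded_color col.
exists i, [set a | cofinal [set x | D x /\ col a x <= i]] => e.
have [l0 _] := infinite_setN0 lambda_inf.
have Dinf := cofinal_infinite lambda_card lambda_inf D_cofinal.
have segL : [set a : kappa | a < e] #<= [set: lambda].
  apply: card_le_trans (succ_card_segment lambda_inf kappa_card kappa_succ e).
  by apply: subset_card_le => a; exact: ltW.
(* [f] filters the ordinals below [e]: the piece at [x] consists of those with [f]-value at most
   [x]. *)
have [f [_ finj]] := card_leE l0 segL.
have /choice[b bP] : forall x, exists b, e <= b /\
    forall a, a < e -> f a <= x -> c a b = col a x.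
  move=> x; have [|b [eb bP]] := colP x [set a | a < e /\ f a <= x] e.
    by apply: (@card_le_fun _ _ _ _ f) => [a []//|u v [ue _] [ve _]]; exact: finj.
  by exists b; split=> // a ae fax; exact: bP.
(* This good ordinal is the point of the block that later blocks must meet with a small colour. *)
have [a0 ea0 a0P] := iP e.
have [p [pe pinj]] : exists p : lambda -> kappa,
    (forall x, D x -> e <= p x) /\ forall x y, D x -> D y -> p x = p y -> x = y.
  apply: (@card_leE _ _ a0 D [set y | e <= y]).
  exact: card_le_trans (card_leT _)
    (succ_card_tail lambda_inf kappa_card kappa_succ e).
(* The set [p @` D] only pads the block to size exactly [D]. *)
exists (b @` D `|` [set a0] `|` p @` D); split.
- apply/card_eqPle; split.
    apply: card_le_setU => //; last exact: card_image_le.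
    apply: card_le_setU => //; first exact: card_image_le.
    have [x Dx] := infinite_setN0 Dinf.
    by apply: (@card_le_fun _ _ _ _ (fun=> x)) => // u v -> ->.
  apply: (@card_le_fun _ _ _ _ p) => // x Dx; right.
  by exists x.
- move=> y [[[x _ <-]|->//]|[x Dx <-]]; last exact: pe.
  by have [] := bP x.
- by exists a0 => //; left; right.
- (* Among the cofinally many good [l], one is at least the index [f x]. *)
  move=> x xP xe; have [l [Dl colxl] fl] := xP (f x).
  exists (b l); first by left; left; exists l.
  by have [_ ->] := bP l.
Qed.

(** Blocks are based at the points [h u]. As [g] bounds each block and [h] dominates the earlier
    values of [g], every block ends below the base of the next ones. *)
Lemma no_large_color : exists i : theta, exists A : set (set kappa),
  [/\ forall a, A a -> a #= D, A #= [set: kappa], trivIset A id,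
    forall a b, A a -> A b -> a <> b -> set_lt a b \/ set_lt b a &
    forall a b, A a -> A b -> a <> b -> set_lt a b ->
      exists x y, [/\ a x, b y & c x y <= i]].
Proof.
have [i [P /choice[a aP]]] := block_exists.
have DL : D #<= [set: lambda] by exact: card_leT.
have /choice[g gP] : forall e, exists m, forall y, a e y -> y < m.
  move=> e; apply: bounded; have [/card_eqPle[aD _] _ _ _] := aP e.
  exact: card_le_trans aD DL.
have [|h hP] := @dominating_sequence _ kappa g kappa_card.1.
  move=> f x; have [|m mP] := bounded (E := f @` [set y | y < x]).
    apply: card_le_trans (card_image_le _ _) _.
    apply: card_le_trans (succ_card_segment lambda_inf kappa_card kappa_succ x).
    by apply: subset_card_le => y; exact: ltW.
  by exists m => y yx; apply/ltW/mP; exists y.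
have ah_lt u v : u < v -> forall x, a (h u) x -> x < h v.
  by move=> uv x /gP xg; exact: lt_le_trans xg (hP _ _ uv).
have ah_set_lt u v : u < v -> set_lt (a (h u)) (a (h v)).
  move=> uv x y /(ah_lt _ _ uv) xh ay; apply: lt_le_trans xh _.
  by have [_ + _ _] := aP (h v); apply.
(* A block is nonempty, hence not below itself; so distinct indices give distinct blocks and the
   family has size [kappa]. *)
have set_lt_irr u v : a (h u) = a (h v) -> ~ set_lt (a (h u)) (a (h v)).
  move=> uv; have [_ _ [x ax _] _] := aP (h u).
  by move=> /(_ x x ax); rewrite -uv ltxx => /(_ ax).
have ah_inj u v : a (h u) = a (h v) -> u = v.
  move=> uv; have [uv'|vu|//] := ltgtP u v.
    by have := set_lt_irr _ _ uv (ah_set_lt _ _ uv').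
  by have := set_lt_irr _ _ (esym uv) (ah_set_lt _ _ vu).
exists i, (range (a \o h)); split.
- by move=> _ [u _ <-]; have [] := aP (h u).
- by apply: inj_card_eq => u v _ _; exact: ah_inj.
- move=> _ _ [u _ <-] [v _ <-] [x [/= ux vx]]; congr (a (h _)).
  have [uv|vu|//] := ltgtP u v.
    by have := ah_set_lt _ _ uv x x ux vx; rewrite ltxx.
  by have := ah_set_lt _ _ vu x x vx ux; rewrite ltxx.
- move=> _ _ [u _ <-] [v _ <-] /= uv.
  have [luv|lvu|e] := ltgtP u v; [left|right|by rewrite e in uv]; exact: ah_set_lt.
- move=> _ _ [u _ <-] [v _ <-] /= uv auv.
  have {}uv : u < v.
    have [//|vu|e] := ltgtP u v; last by rewrite e in uv.
    have [_ _ [x ux _] _] := aP (h u); have [_ _ [y vy _] _] := aP (h v).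
    by have := lt_trans (auv _ _ ux vy) (ah_set_lt _ _ vu _ _ vy ux); rewrite ltxx.
  have [_ _ [x ux Px] _] := aP (h u); have [_ _ _ vP] := aP (h v).
  (* The good point [x] of the earlier block lies below the base [h v] of the later one. *)
  have [y vy cxy] := vP x Px (ah_lt _ _ uv _ ux).
  by exists x, y.
Qed.

End SingularLimit.

Theorem theorem2p11
    (dL dK dT : Order.disp_t)
    (lambda : orderType dL) (kappa : orderType dK) (theta : orderType dT)
    (C : Type) (cf : set C) (X : Type) (chi : set X)
    (lambda_singular : singular_cardinal lambda)
    (lambda_limit : limit_of_strongly_compacts lambda)
    (kappa_cardinal : is_cardinal kappa)
    (kappa_succ : is_succ_card [set: lambda] [set: kappa])
    (cf_lambda : is_cofinality lambda cf)
    (chi_succ : is_succ_card cf chi)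
    (theta_regular : regular_cardinal theta)
    (theta_lt : [set: theta] #< [set: lambda])
    (theta_neq : ~ ([set: theta] #= cf)) :
  ~ U_principle kappa `I_2 theta chi.
Proof.
move=> [c cU].
have [lcard linf _] := lambda_singular.
have [[D Dcof Dcf] cfmin] := cf_lambda.
have /card_eqPle[D_cf cf_D] := Dcf.
have Dcofinality : is_cofinality lambda D.
  split; first by exists D => //; exact: card_eqxx.
  by move=> E /cfmin; exact: card_le_trans.
have thD : ~ ([set: theta] #= D).
  by move=> thD; apply: theta_neq; exact: card_eq_trans thD Dcf.
have [i [A [AD Akappa Atriv Acmp Ac]]] := no_large_color c lcard linf
  lambda_limit kappa_cardinal kappa_succ Dcofinality Dcof theta_regular theta_lt
  thD.
(* The blocks have size [cf], which is below its successor [chi], so the principle applies to them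
   with the colour [i]. *)
have [B [BA B2 BP]] :=
  cU _ D (card_le_lt_trans D_cf chi_succ.1) A AD Akappa Atriv i.
have /card_eqPle[_ /(card_leE (set0 : set kappa))[f [fB finj]]] := B2.
have [f0 f1] : B (f 0%N) /\ B (f 1%N) by split; exact: fB.
have f01 : f 0%N <> f 1%N by move=> /(finj _ _ _ _)/= /(_ isT isT).
have contra a b : B a -> B b -> a <> b -> ~ set_lt a b.
  move=> Ba Bb ab lab.
  have [x [y [ax b_y cxy]]] := Ac _ _ (BA _ Ba) (BA _ Bb) ab lab.
  have [m [_ mmin] im] := BP _ _ Ba Bb ab lab.
  have mc : m <= c x y by apply: mmin; exists x => //; exists y.
  by have := lt_le_trans im (le_trans mc cxy); rewrite ltxx.
(* The two chosen blocks are ordered one way or the other, and either order is contradictory. *)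
have [|] := Acmp _ _ (BA _ f0) (BA _ f1) f01; first exact: contra.
by apply: contra => // /esym.
Qed.
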